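(* There are absolute constants $K_0,c,C>0$ and an integer $n_0\ge1$ with the following property. Let $n\ge n_0$ and $d\ge1$ be integers and let $p$ be an integer such that $1\le p\le c\,n/d^2$. For each of the following two inequalities (1) and (2), there exist (possibly different for (1) and (2)) independent random variables $X_1,\ldots,X_n$ with $\mathbb{E}X_i=0$, $\mathbb{E}X_i^2=1$, $\|X_i\|_{\psi_2}\le K_0$, and a convex $1$-Lipschitz function $f:H_d\to\mathbb{R}$ such that, with $X=(X_1,\ldots,X_n)$, the inequality holds for every $m\in\mathbb{R}$: $$\text{(1)}\qquad \mathbb{P}\left\{|f(X^{\otimes d})-m|\ge c\,d\,n^{(d-1)/2}\sqrt p\right\}\ge e^{-Cp};$$ $$\text{(2)}\qquad \mathbb{P}\left\{|f(X^{\otimes d})-m|\ge c\,n^{(d-1)/2}\sqrt{d\,p\log\left(e+\frac np\right)}\right\}\ge e^{-Cp}.$$ Consequently, there is an absolute constant $c'>0$ such that for all such $n,d,p$ there are independent centered variance-one $X_i$ with $\|X_i\|_{\psi_2}\le K_0$ and a convex $1$-Lipschitz $f:H_d\to\mathbb{R}$ such that $Z=f(X^{\otimes d})$ satisfies $$\|Z-\mathbb{E}Z\|_{L_p}\ge c'\,n^{(d-1)/2}\left(d\sqrt p+\sqrt{d\,p\log\left(e+\frac np\right)}\right).$$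
   Context: $H_d=(\mathbb{R}^n)^{\otimes d}$ is the Hilbert-space tensor product of $d$ copies of Euclidean $\mathbb{R}^n$, with its Hilbert norm; Lipschitz is with respect to this norm. $X^{\otimes d}=X\otimes\cdots\otimes X$ ($d$ factors). $\|W\|_{L_p}=(\mathbb{E}|W|^p)^{1/p}$ and $\|W\|_{\psi_2}=\inf\{a>0:\mathbb{E}\exp(W^2/a^2)\le 2\}$. *)

(* Defs.v *)
From HB Require Import structures.
From mathcomp Require Import all_boot all_order all_algebra.
From mathcomp Require Import all_classical all_reals all_analysis.

Set Implicit Arguments.
Unset Strict Implicit.
Unset Printing Implicit Defensive.

Import Order.TTheory GRing.Theory Num.Theory.

Local Open Scope classical_set_scope.
Local Open Scope ring_scope.

(* (R^n)^{⊗d}, in coordinates with respect to the orthonormal basis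
   e_{a 0} ⊗ ... ⊗ e_{a (d-1)}, where a ranges over maps 'I_d -> 'I_n.
   The codomain R^o provides the lmodType structure. *)
Notation tensor_space R n d := {ffun {ffun 'I_d -> 'I_n} -> R^o}.

Definition tensor_dot (R : realType) (n d : nat) (u v : tensor_space R n d) : R :=
  \sum_a (u a : R) * v a.

Definition tensor_norm (R : realType) (n d : nat) (u : tensor_space R n d) : R :=
  Num.sqrt (tensor_dot u u).

Definition elementary_tensor (R : realType) (n d : nat) (x : 'I_d -> 'I_n -> R) :
    tensor_space R n d :=
  [ffun a : {ffun 'I_d -> 'I_n} => (\prod_(k < d) x k (a k) : R^o)].

Definition tensor_power (R : realType) (n d : nat) (x : 'I_n -> R) :
    tensor_space R n d :=
  elementary_tensor (fun _ : 'I_d => x).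

(* The defining property of the inner product of a Hilbert tensor product. *)
Lemma tensor_dot_elementary (R : realType) (n d : nat)
    (x y : 'I_d -> 'I_n -> R) :
  tensor_dot (elementary_tensor x) (elementary_tensor y) =
  \prod_(k < d) \sum_(i < n) x k i * y k i.
Proof.
rewrite bigA_distr_bigA /tensor_dot; apply: eq_bigr => a _.
by rewrite !ffunE -big_split.
Qed.

(* The library's k.-lipschitz is stated for a normedModType; here the norm is
   tensor_norm. *)
Definition lipschitz1 (R : realType) (n d : nat) (f : tensor_space R n d -> R) :
    Prop :=
  forall u v, `|f u - f v| <= tensor_norm (u - v).

(* Subfamilies are covered by taking some of the A i to be setT. *)
Definition mutually_independent (disp : measure_display)
    (T : measurableType disp) (R : realType) (P : probability T R) (n : nat)
    (X : 'I_n -> {RV P >-> R}) : Prop :=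
  forall A : 'I_n -> set R, (forall i, measurable (A i)) ->
    (P (\bigcap_(i in [set: 'I_n]) (X i @^-1` A i)) =
     \prod_(i < n) P (X i @^-1` A i))%E.

(* Equal to +oo when no a is admissible. *)
Definition psi2_norm (disp : measure_display) (T : measurableType disp)
    (R : realType) (P : probability T R) (W : T -> R) : \bar R :=
  ereal_inf [set a%:E | a in
    [set a : R | 0 < a /\ ('E_P[fun w => expR (W w ^+ 2 / a ^+ 2)%R] <= 2%:E)%E]].

Definition normalized_subgaussian (disp : measure_display)
    (T : measurableType disp) (R : realType) (P : probability T R) (n : nat)
    (K0 : R) (X : 'I_n -> {RV P >-> R}) : Prop :=
  mutually_independent X /\
  forall i, [/\ ('E_P[X i] = 0)%E, ('E_P[fun w => (X i w ^+ 2)%R] = 1)%E &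
                (psi2_norm P (X i) <= K0%:E)%E].

Definition convex_lipschitz1 (R : realType) (n d : nat)
    (f : tensor_space R n d -> R) : Prop :=
  convex_function [set: tensor_space R n d] f /\ lipschitz1 f.

Definition anti_concentration (R : realType) (n d : nat) (K0 t q : R) : Prop :=
  exists (disp : measure_display) (T : measurableType disp)
      (P : probability T R) (X : 'I_n -> {RV P >-> R})
      (f : tensor_space R n d -> R),
    [/\ normalized_subgaussian K0 X,
        convex_lipschitz1 f &
        forall m : R,
          (q%:E <= P [set w | (t <= `|f (tensor_power d (X ^~ w)) - m|)%R])%E].

(* Main.v *)
Require Import Defs.
From HB Require Import structures.
From mathcomp Require Import all_boot all_order all_algebra.
From mathcomp Require Import all_classical all_reals all_analysis.
From mathcomp Require Import ring lra.

(** The two inequalities come from two different families of variables.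

    A deviation from every centre m follows once the function has two separated
    levels, each attained with probability at least e^(-Cp)
    ([two_level_deviation]). The functions are the Euclidean distances to the
    cubes of tensors with entries bounded by theta, that is, norms of
    soft-thresholded tensors ([thresholded_norm]): they are convex and
    1-Lipschitz. The variables are symmetric with two possible absolute values,
    on a finite product space, so that all probabilities are finite sums.

    For (1) take theta = 0. The norm of the d-th tensor power of X is |X|^d, with
    derivative d n^((d-1)/2) in |X| near |X| = sqrt n, so it is enough that |X|
    fluctuates by sqrt p with probability e^(-Cp). When X_i^2 is 0 or 2 with equal
    probability, |X|^2 - n is a sum of n fair signs, and its moderate deviations
    of order sqrt(n p) are obtained from the Paley-Zygmund inequality applied to
    an exponential ([sign_sum_deviation], [norm_anti_concentration]).

    For (2) let each X_i be, up to sign, of order sqrt(ln(n/p)) with probability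
    p/n, which is as large as a sub-Gaussian variable may be, and an almost unit
    constant b otherwise. With theta = b^d the function vanishes if no coordinate
    is large. If p coordinates are large, the d p (n-p)^(d-1) entries of the
    tensor power with exactly one large factor all exceed the threshold by order
    sqrt(ln(n/p)), which gives the size of (2). Both events have probability at
    least e^(-2p) ([sparse_anti_concentration]).

    The L_p bound is the tail bound with m = E Z raised to the power p, applied
    to whichever of the two examples has the larger scale
    ([finite_anti_concentration_Lnorm]). *)

Set Implicit Arguments.
Unset Strict Implicit.
Unset Printing Implicit Defensive.

Import Order.TTheory GRing.Theory Num.Theory.

Local Open Scope classical_set_scope.
Local Open Scope ring_scope.

(** * Finite probability spaces with product weights *)

(** An outcome gives to each coordinate a sign and a flag telling whether the
    coordinate is large; the space is finite, so it carries the discrete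
    sigma-algebra and every function on it is measurable. *)
Definition outcomes (n : nat) := {ffun 'I_n -> bool * bool}.

HB.instance Definition _ n := Finite.on (outcomes n).
HB.instance Definition _ n :=
  isPointed.Build (outcomes n) [ffun=> (false, false)].
HB.instance Definition _ n :=
  @isMeasurable.Build default_measure_display (outcomes n)
    (@discrete_measurable (outcomes n))
    (@discrete_measurable0 (outcomes n)) (@discrete_measurableC (outcomes n))
    (@discrete_measurableU (outcomes n)).

(** Phrased with integrals of arbitrary real functions, so that probabilities,
    expectations and L_p norms all become finite sums. *)
Definition has_weights (R : realType) n (w : outcomes n -> R)
    (P : probability (outcomes n) R) :=
  forall f : outcomes n -> R,
    (\int[P]_x (f x)%:E = (\sum_x w x * f x)%:E)%E.

(** The measure is a finite sum of scaled Dirac masses; integrals against it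
    are sums for nonnegative functions, and the general case follows by taking
    positive and negative parts. *)
Lemma exists_weighted_probability (R : realType) n (w : outcomes n -> R) :
  (forall x, 0 <= w x) -> \sum_x w x = 1 -> exists P, has_weights w P.
Proof.
move=> w0 w1.
pose s := index_enum (outcomes n).
pose x0 : outcomes n := point.
pose m (k : nat) : {measure set (outcomes n) -> \bar R} :=
  mscale (NngNum (w0 (nth x0 s k))) (\d_(nth x0 s k)).
pose Q : {measure set (outcomes n) -> \bar R} := msum m (size s).
have intQ (f : outcomes n -> R) : (forall x, 0 <= f x) ->
    (\int[Q]_x (f x)%:E = (\sum_x w x * f x)%:E)%E.
  move=> f0; rewrite ge0_integral_measure_sum//; last by move=> x _; rewrite lee_fin.
  rewrite -sumEFin -/s.
  rewrite (big_nth x0) big_mkord; apply: eq_bigr => i _.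
  rewrite ge0_integral_mscale//; last by move=> x _; rewrite lee_fin.
  rewrite integral_dirac//.
  by rewrite diracT mul1e.
have QT : Q [set: outcomes n] = 1%E.
  transitivity (\int[Q]_x (cst 1%E x))%E.
    by rewrite integral_cst// mul1e.
  rewrite (intQ (cst 1))//; under eq_bigr do rewrite mulr1.
  by rewrite w1.
pose pQ := Measure_isProbability.Build _ _ _ Q QT.
pose P : probability (outcomes n) R := HB.pack (Measure.sort Q) pQ.
exists P => f.
rewrite integralE.
have -> : (\int[P]_x ((fun x => (f x)%:E)^\+ x) = (\sum_x w x * Num.max (f x) 0)%:E)%E.
  rewrite -(intQ (fun x => Num.max (f x) 0)); last by move=> x; rewrite le_max lexx orbT.
  by apply: eq_integral => x _; rewrite funeposE EFin_max.
have -> : (\int[P]_x ((fun x => (f x)%:E)^\- x) = (\sum_x w x * Num.max (- f x) 0)%:E)%E.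
  rewrite -(intQ (fun x => Num.max (- f x) 0)); last by move=> x; rewrite le_max lexx orbT.
  by apply: eq_integral => x _; rewrite funenegE EFin_max.
rewrite -EFinB -sumrB; congr (_%:E); apply: eq_bigr => x _.
rewrite -mulrBr; congr (_ * _).
have [fx|/ltW fx] := leP 0 (f x).
  by rewrite max_r ?oppr_le0// subr0.
by rewrite max_l ?oppr_ge0// sub0r opprK.
Qed.

Section weights.
Variables (R : realType) (n : nat) (w : outcomes n -> R).
Variables (P : probability (outcomes n) R) (Pw : has_weights w P).

Lemma has_weights_expectation (f : outcomes n -> R) :
  ('E_P[f] = (\sum_x w x * f x)%:E)%E.
Proof. by rewrite unlock Pw. Qed.

Lemma has_weights_prob (A : set (outcomes n)) :
  (P A = (\sum_x w x * (x \in A)%:R)%:E)%E.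
Proof. by rewrite -[A in LHS]setIT -integral_indic//= Pw. Qed.

End weights.

Section product_weights.
Variables (R : realType) (n : nat) (mu : bool * bool -> R).
Hypotheses (mu_ge0 : forall s, 0 <= mu s) (mu_sum : \sum_s mu s = 1).

Definition product_weight (x : outcomes n) : R := \prod_(i < n) mu (x i).

(** Expanding the product of sums gives one term per outcome: expectations of
    products over independent coordinates factor. *)
Lemma sum_product_weight (g : 'I_n -> bool * bool -> R) :
  \sum_x product_weight x * \prod_i g i (x i) =
  \prod_i \sum_s mu s * g i s.
Proof.
rewrite bigA_distr_bigA/=; apply: eq_bigr => x _.
by rewrite /product_weight -big_split.
Qed.

Lemma sum_product_weight_marginal (i : 'I_n) (g : bool * bool -> R) :
  \sum_x product_weight x * g (x i) = \sum_s mu s * g s.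
Proof.
transitivity (\sum_x product_weight x *
    \prod_j (if j == i then g (x j) else 1)).
  apply: eq_bigr => x _; congr (_ * _).
  by rewrite -big_mkcond big_pred1_eq.
rewrite (sum_product_weight (fun j s => if j == i then g s else 1)).
rewrite (bigD1 i)//= eqxx [X in _ * X]big1 ?mulr1// => j /negPf ->.
by under eq_bigr do rewrite mulr1.
Qed.

Lemma product_weight_ge0 x : 0 <= product_weight x.
Proof. exact: prodr_ge0. Qed.

Lemma product_weight_sum : \sum_x product_weight x = 1.
Proof.
transitivity (\sum_x product_weight x * \prod_(i < n) 1).
  by apply: eq_bigr => x _; rewrite big1_eq mulr1.
rewrite (sum_product_weight (fun _ _ => 1)) big1// => i _.
by under eq_bigr do rewrite mulr1.
Qed.

Lemma product_weight_independent (P : probability (outcomes n) R)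
    (X : 'I_n -> {RV P >-> R}) (xi : bool * bool -> R) :
  has_weights product_weight P -> (forall i x, X i x = xi (x i)) ->
  mutually_independent X.
Proof.
move=> Pw Xxi A mA; rewrite (has_weights_prob Pw).
transitivity (\prod_(i < n) (\sum_s mu s * (xi s \in A i)%:R)%:E)%E.
  rewrite prodEFin -sum_product_weight; congr (_%:E); apply: eq_bigr => x _.
  congr (_ * _); rewrite -natr_prod; congr (_%:R).
  have [|] := boolP (x \in _).
    rewrite inE => xA; rewrite big1// => i _.
    by rewrite mem_set// -Xxi; exact: (xA i).
  rewrite notin_setE => xA; apply/eqP; rewrite eq_sym.
  have [i xAi] : exists i, ~ A i (X i x).
    by apply/existsNP => h; apply: xA => i _; exact: h.
  by rewrite (bigD1 i)//= -Xxi memNset.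
apply: eq_bigr => i _; rewrite (has_weights_prob Pw) -(sum_product_weight_marginal i).
congr (_%:E); apply: eq_bigr => x _; congr (_ * _%:R).
by apply/congr1/asbool_equiv_eq; rewrite /= Xxi.
Qed.

End product_weights.

(** * Euclidean norm and distance to a cube of tensors *)

Section l2.
Variables (R : realType) (I : finType).
Implicit Types u v : I -> R.

Definition l2norm u : R := Num.sqrt (\sum_i u i ^+ 2).

Lemma sum_sqr_ge0 u : 0 <= \sum_i u i ^+ 2.
Proof. by apply: sumr_ge0 => i _; exact: sqr_ge0. Qed.

Lemma l2norm_ge0 u : 0 <= l2norm u.
Proof. exact: sqrtr_ge0. Qed.

Lemma sqr_l2norm u : l2norm u ^+ 2 = \sum_i u i ^+ 2.
Proof. exact/sqr_sqrtr/sum_sqr_ge0. Qed.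

(** With U, V the sums of squares and D the scalar product, the sum of the
    squares (u_i V - v_i D)^2 equals V (U V - D^2). *)
Lemma cauchy_schwarz_sum u v :
  (\sum_i u i * v i) ^+ 2 <= (\sum_i u i ^+ 2) * (\sum_i v i ^+ 2).
Proof.
set D := \sum_i u i * v i; set U := \sum_i u i ^+ 2; set V := \sum_i v i ^+ 2.
have V0 : 0 <= V := sum_sqr_ge0 v.
have [Veq0|Vn0] := eqVneq V 0.
  have v0 i : v i = 0.
    apply/eqP; rewrite -sqrf_eq0; apply/eqP.
    by apply: (psumr_eq0P _ Veq0) => // j _; exact: sqr_ge0.
  have -> : D = 0 by rewrite /D big1// => i _; rewrite v0 mulr0.
  by rewrite expr0n/= mulr_ge0// sum_sqr_ge0.
have Vp : 0 < V by rewrite lt_neqAle eq_sym Vn0.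
have : 0 <= \sum_i (u i * V - v i * D) ^+ 2.
  by apply: sumr_ge0 => i _; exact: sqr_ge0.
have -> : \sum_i (u i * V - v i * D) ^+ 2 = V * (U * V - D ^+ 2).
  transitivity (\sum_i (V ^+ 2 * u i ^+ 2 - 2 * V * D * (u i * v i)
                        + D ^+ 2 * v i ^+ 2)).
    by apply: eq_bigr => i _; ring.
  by rewrite big_split/= sumrB -!mulr_sumr -/U -/V -/D; ring.
by rewrite pmulr_rge0// subr_ge0.
Qed.

Lemma l2norm_triangle u v : l2norm (fun i => u i + v i) <= l2norm u + l2norm v.
Proof.
have uv0 : 0 <= l2norm u + l2norm v by rewrite addr_ge0 ?l2norm_ge0.
rewrite -(ler_pXn2r (n := 2))// ?nnegrE ?l2norm_ge0//.
rewrite sqrrD !sqr_l2norm.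
under eq_bigr do rewrite sqrrD.
rewrite !big_split/= lerD2r lerD2l -mulr2n lerMn2r/=.
have := cauchy_schwarz_sum u v.
rewrite -!sqr_l2norm -exprMn => h.
apply: le_trans (ler_norm _) _.
rewrite -(ler_pXn2r (n := 2))// ?nnegrE// ?mulr_ge0 ?l2norm_ge0//.
by rewrite real_normK// num_real.
Qed.

Lemma l2norm_le u v : (forall i, `|u i| <= `|v i|) -> l2norm u <= l2norm v.
Proof.
move=> uv; rewrite ler_wsqrtr//; apply: ler_sum => i _.
by rewrite -(real_normK (num_real (u i))) -(real_normK (num_real (v i))) lerXn2r ?nnegrE.
Qed.

Lemma l2normZ (c : R) u : 0 <= c -> l2norm (fun i => c * u i) = c * l2norm u.
Proof.
move=> c0; rewrite /l2norm; under eq_bigr do rewrite exprMn.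
by rewrite -mulr_sumr sqrtrM ?sqr_ge0// sqrtr_sqr ger0_norm.
Qed.

End l2.

Section soft_threshold.
Variables (R : realType).

Definition soft_threshold (theta x : R) : R := Num.max (`|x| - theta) 0.

Lemma soft_threshold_ge0 theta x : 0 <= soft_threshold theta x.
Proof. by rewrite /soft_threshold le_max lexx orbT. Qed.

Lemma soft_threshold_dist theta x y :
  `|soft_threshold theta x - soft_threshold theta y| <= `|x - y|.
Proof.
have := ler_dist_dist x y; rewrite /soft_threshold.
have [hx|hx] := leP (`|x| - theta) 0; have [hy|hy] := leP (`|y| - theta) 0;
 rewrite !ler_norml => /andP[h1 h2]; apply/andP; split; lra.
Qed.

Lemma soft_threshold_convex theta x y s : 0 <= s <= 1 ->
  soft_threshold theta (s * x + (1 - s) * y) <=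
  s * soft_threshold theta x + (1 - s) * soft_threshold theta y.
Proof.
move=> /andP[s0 s1].
have s1' : 0 <= 1 - s by lra.
rewrite {1}/soft_threshold ge_max; apply/andP; split; last first.
  by rewrite addr_ge0// mulr_ge0// soft_threshold_ge0.
have hx : `|x| - theta <= soft_threshold theta x by rewrite le_max lexx.
have hy : `|y| - theta <= soft_threshold theta y by rewrite le_max lexx.
have := ler_normD (s * x) ((1 - s) * y).
rewrite !normrM (ger0_norm s0) (ger0_norm s1') => h.
have := ler_wpM2l s0 hx; have := ler_wpM2l s1' hy; lra.
Qed.

Variables (n d : nat) (theta : R).

(** The Euclidean distance to the cube of all tensors with entries bounded by
    theta (the norm itself when theta = 0). *)
Definition thresholded_norm (u : tensor_space R n d) : R :=
  l2norm (fun a => soft_threshold theta (u a)).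

Lemma tensor_normE (u : tensor_space R n d) : tensor_norm u = l2norm (u : _ -> R).
Proof. by []. Qed.

(** Soft thresholding is convex, nonnegative and a contraction entrywise; these
    properties pass to the Euclidean norm by its monotonicity and the triangle
    inequality. *)
Lemma thresholded_norm_convex_lipschitz1 : convex_lipschitz1 thresholded_norm.
Proof.
split.
  move=> t u v _ _.
  have /andP[t0 t1] : 0 <= (t%:num : R) <= 1 by rewrite ge0 le1.
  have t1' : 0 <= 1 - (t%:num : R) by lra.
  rewrite convRE /unstable.onem /thresholded_norm -!l2normZ//.
  apply: le_trans (l2norm_triangle _ _); apply: l2norm_le => a.
  rewrite ger0_norm ?soft_threshold_ge0// ger0_norm; last first.
    by rewrite addr_ge0// mulr_ge0// soft_threshold_ge0.
  rewrite !ffunE; apply: soft_threshold_convex; exact/andP.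
have half u v : thresholded_norm u - thresholded_norm v <= tensor_norm (u - v).
  rewrite lerBlDl.
  pose w a := soft_threshold theta (u a) - soft_threshold theta (v a).
  have -> : thresholded_norm u =
      l2norm (fun a => soft_threshold theta (v a) + w a).
    by congr Num.sqrt; apply: eq_bigr => a _; rewrite subrKC.
  apply: le_trans (l2norm_triangle _ _) _.
  rewrite lerD2l tensor_normE; apply: l2norm_le => a.
  by rewrite !ffunE; exact: soft_threshold_dist.
move=> u v; rewrite ler_norml half andbT lerNl opprB.
have -> : tensor_norm (u - v) = tensor_norm (v - u).
  by congr Num.sqrt; apply: eq_bigr => a _; rewrite !ffunE; ring.
exact: half.
Qed.

End soft_threshold.

(** * Symmetric variables with two absolute values *)

Section four_point_law.
Variables (R : realType) (q a b : R).

(** The common law of the coordinates: the large flag has probability q and the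
    sign is fair and independent of it, so the variable equals +a or -a with
    probability q / 2 each and +b or -b with probability (1 - q) / 2 each. *)
Definition four_point_weight (s : bool * bool) : R :=
  (if s.2 then q else 1 - q) / 2.

Definition four_point_value (s : bool * bool) : R :=
  (-1) ^+ s.1 * (if s.2 then a else b).

Lemma sum_four_point (g : bool * bool -> R) :
  \sum_s four_point_weight s * g s =
  q * ((g (true, true) + g (false, true)) / 2) +
  (1 - q) * ((g (true, false) + g (false, false)) / 2).
Proof.
transitivity (\sum_(i : bool) \sum_(j : bool)
    four_point_weight (i, j) * g (i, j)).
  by rewrite pair_bigA; apply: eq_bigr => -[].
by rewrite !big_bool/= /four_point_weight/=; field.
Qed.

Lemma sum_four_point_weight : \sum_s four_point_weight s = 1.
Proof.
have := sum_four_point (fun=> 1); under eq_bigr do rewrite mulr1.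
by move=> ->; field.
Qed.

Lemma sqr_four_point_value s :
  four_point_value s ^+ 2 = if s.2 then a ^+ 2 else b ^+ 2.
Proof. by rewrite exprMn sqrr_sign mul1r; case: s.2. Qed.

Lemma normr_four_point_value s : 0 <= a -> 0 <= b ->
  `|four_point_value s| = if s.2 then a else b.
Proof. by move=> a0 b0; rewrite normrM normr_sign mul1r; case: s.2; rewrite ger0_norm. Qed.

(** Fair signs give mean zero, and the last two hypotheses are the variance and
    the moment E exp(X^2 / 2^2) that certifies a psi_2 norm at most 2. *)
Lemma exists_four_point_family n : 0 <= q <= 1 ->
  q * a ^+ 2 + (1 - q) * b ^+ 2 = 1 ->
  q * expR (a ^+ 2 / 4) + (1 - q) * expR (b ^+ 2 / 4) <= 2 ->
  exists (P : probability (outcomes n) R) (X : 'I_n -> {RV P >-> R}),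
    [/\ has_weights (product_weight four_point_weight) P,
        forall i x, X i x = four_point_value (x i) &
        normalized_subgaussian 2 X].
Proof.
move=> /andP[q0 q1] var1 exp2.
have q1' : 0 <= 1 - q by rewrite subr_ge0.
have mu0 s : 0 <= four_point_weight s.
  by rewrite divr_ge0//; case: s.2.
have [P Pw] := exists_weighted_probability (product_weight_ge0 mu0)
  (product_weight_sum n sum_four_point_weight).
have mf i : measurable_fun [set: outcomes n]
    (fun x : outcomes n => four_point_value (x i)) by move=> ? ? ?.
pose X i : {RV P >-> R} := HB.pack (fun x : outcomes n => four_point_value (x i))
  (isMeasurableFun.Build _ _ _ _ _ (mf i)).
exists P, X; split => //; split.
  exact: (product_weight_independent sum_four_point_weight Pw).
move=> i; have E (g : R -> R) :
    ('E_P[fun x => g (X i x)] =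
     (\sum_s four_point_weight s * g (four_point_value s))%:E)%E.
  rewrite (has_weights_expectation Pw); congr (_%:E).
  by rewrite -(sum_product_weight_marginal sum_four_point_weight i).
split.
- by rewrite (E id) sum_four_point /four_point_value/=; congr (_%:E); ring.
- rewrite (E (fun y => y ^+ 2)) sum_four_point !sqr_four_point_value/=.
  by congr (_%:E); rewrite -[X in _ = X]var1; field.
- rewrite /psi2_norm; apply: ereal_inf_lbound; exists 2 => //; split => //.
  rewrite (E (fun y => expR (y ^+ 2 / 2 ^+ 2))) lee_fin sum_four_point.
  rewrite !sqr_four_point_value/= (_ : 2 ^+ 2 = 4 :> R); last by ring.
  by apply: le_trans exp2; rewrite le_eqVlt; apply/orP; left; apply/eqP; field.
Qed.

End four_point_law.

(** * From two levels to anti-concentration *)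

Section finite_anti_concentration.
Variable R : realType.

(** Anti-concentration realized on a finite probability space. Keeping the
    weights visible makes every function of the outcome measurable, so one and
    the same witness gives the tail bound and the L_p bound. *)
Definition finite_anti_concentration (n d : nat) (K t r : R) : Prop :=
  exists (w : outcomes n -> R) (P : probability (outcomes n) R)
      (X : 'I_n -> {RV P >-> R}) (f : tensor_space R n d -> R),
    [/\ has_weights w P /\ (forall x, 0 <= w x),
        normalized_subgaussian K X, convex_lipschitz1 f &
        forall m : R,
          r <= \sum_(x | t <= `|f (tensor_power d (X ^~ x)) - m|) w x].

Lemma finite_anti_concentrationW n d (K t t' r r' : R) :
  t' <= t -> r' <= r ->
  finite_anti_concentration n d K t r -> anti_concentration n d K t' r'.
Proof.
move=> tt rr [w [P [X [f [[Pw w0] Xn fc h]]]]].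
exists _, (outcomes n), P, X, f; split => // m.
rewrite (has_weights_prob Pw) lee_fin (le_trans rr)// (le_trans (h m))//.
rewrite big_mkcond/=; apply: ler_sum => x _.
case: ifPn => tx; last by rewrite mulr_ge0.
by rewrite mem_set ?mulr1//=; exact: le_trans tx.
Qed.

(** Markov's inequality at the centre m = E Z: the p-th moment is at least
    t^p e^(-Cp), and its p-th root is t e^(-C). *)
Lemma finite_anti_concentration_Lnorm n d (K t C s : R) (p : nat) :
  (1 <= p)%N -> 0 <= t -> s <= t * expR (- C) ->
  finite_anti_concentration n d K t (expR (- (C * p%:R))) ->
  exists (disp : measure_display) (T : measurableType disp)
      (P : probability T R) (X : 'I_n -> {RV P >-> R})
      (f : tensor_space R n d -> R),
    [/\ normalized_subgaussian K X, convex_lipschitz1 f &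
        let Z (w : T) : R := f (tensor_power d (X ^~ w)) in
        (s%:E <=
          'N[P]_(p%:R%:E) [(fun w => (Z w - fine 'E_P[Z])%:E)])%E].
Proof.
move=> p1 t0 st [w [P [X [f [[Pw w0] Xn fc h]]]]].
exists _, (outcomes n), P, X, f; split => //=.
set m := fine _; set Z := fun x : outcomes n => f (tensor_power d (X ^~ x)) - m.
have p0 : p%:R != 0 :> R by rewrite pnatr_eq0 -lt0n.
rewrite unlock /=.
have -> : (\int[P]_x `|(Z x)%:E| `^ p%:R = (\sum_x w x * `|Z x| ^+ p)%:E)%E.
  rewrite -(Pw (fun x => `|Z x| ^+ p)); apply: eq_integral => x _.
  by rewrite abse_EFin poweR_EFin powR_mulrn.
rewrite poweR_EFin lee_fin; apply: (le_trans st).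
have -> : t * expR (- C) = (t ^+ p * expR (- (C * p%:R))) `^ (p%:R^-1).
  rewrite mulrC -mulNr [_ * p%:R]mulrC expRM_natl -exprMn.
  rewrite -powR_mulrn; last by rewrite mulr_ge0// expR_ge0.
  by rewrite -powRrM mulfV// powRr1 ?mulr_ge0 ?expR_ge0// mulrC.
apply: ge0_ler_powR; rewrite ?invr_ge0//.
- by rewrite nnegrE mulr_ge0 ?exprn_ge0 ?expR_ge0.
- by rewrite nnegrE sumr_ge0// => x _; rewrite mulr_ge0 ?exprn_ge0.
apply: (@le_trans _ _ (t ^+ p * \sum_(x | t <= `|Z x|) w x)).
  by rewrite ler_wpM2l ?exprn_ge0//; exact: h.
rewrite mulr_sumr big_mkcond/=; apply: ler_sum => x _.
case: ifPn => tx; last by rewrite mulr_ge0 ?exprn_ge0.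
by rewrite mulrC ler_wpM2l// lerXn2r ?nnegrE.
Qed.

(** If Z lies below l on A and above l + 2 t on B, any centre m is at distance at
    least t from one of the two ranges, so deviating from m is at least as likely
    as the less likely of the two events. *)
Lemma two_level_deviation (T : finType) (w Z : T -> R) (A B : pred T)
    (r t l m : R) :
  (forall x, 0 <= w x) ->
  r <= \sum_(x | A x) w x -> r <= \sum_(x | B x) w x ->
  (forall x, A x -> Z x <= l) -> (forall x, B x -> l + 2 * t <= Z x) ->
  r <= \sum_(x | t <= `|Z x - m|) w x.
Proof.
move=> w0 rA rB ZA ZB.
have sub (D : pred T) : (forall x, D x -> t <= `|Z x - m|) ->
    \sum_(x | D x) w x <= \sum_(x | t <= `|Z x - m|) w x.
  move=> DZ; rewrite big_mkcond [leRHS]big_mkcond/=; apply: ler_sum => x _.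
  by case: ifPn => [/DZ ->//|_]; case: ifP.
have [lm|lm] := leP (l + t) m.
- apply: (le_trans rA); apply: sub => x /ZA Zl.
  by rewrite distrC (le_trans _ (ler_norm _))//; lra.
- apply: (le_trans rB); apply: sub => x /ZB Zl.
  by rewrite (le_trans _ (ler_norm _))//; lra.
Qed.

End finite_anti_concentration.

(** * Elementary exponential bounds and the Paley-Zygmund inequality *)

Section elementary_bounds.
Variable R : realType.
Implicit Types x y : R.

Lemma bernoulli_ineq x m : -1 <= x -> 1 + m%:R * x <= (1 + x) ^+ m.
Proof.
move=> x1; elim: m => [|m IH]; first by rewrite mul0r addr0 expr0.
have : 0 <= 1 + x by lra.
move=> /ler_wpM2l /(_ _ _ IH); rewrite exprS; apply: le_trans.
have := mulr_ge0 (ler0n R m) (sqr_ge0 x).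
by rewrite -natr1; nra.
Qed.

Lemma expR_le_inv x : x < 1 -> expR x <= (1 - x)^-1.
Proof.
move=> x1; have x0 : 0 < 1 - x by rewrite subr_gt0.
have := expR_ge1Dx (- x); rewrite expRN => h.
by rewrite -[leLHS]invrK lef_pV2 ?posrE ?invr_gt0 ?expR_gt0.
Qed.

Lemma expR1_bounds : 2 <= expR 1 :> R /\ expR 1 <= 4 :> R.
Proof.
split; first by have := expR_ge1Dx (1 : R); lra.
have -> : expR 1 = expR (2^-1) ^+ 2 :> R.
  by rewrite -expRM_natl; congr expR; lra.
have -> : 4 = 2 ^+ 2 :> R by ring.
rewrite lerXn2r ?nnegrE ?expR_ge0//.
rewrite -[leRHS]invrK (_ : 2^-1 = 1 - 2^-1 :> R); last by lra.
by rewrite {1}(_ : 1 - 2^-1 = 2^-1 :> R); [apply: expR_le_inv; lra|lra].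
Qed.

Lemma expR_half_le x : 0 <= x <= 1 -> expR (x / 2) <= 1 + x.
Proof.
move=> /andP[x0 x1]; apply: le_trans (expR_le_inv _) _; first by lra.
by rewrite invf_ple ?posrE; [|lra|lra]; rewrite -[leLHS]mul1r ler_pdivrMr; nra.
Qed.

Lemma expRN2_le x : 0 <= x <= 2^-1 -> expR (- (2 * x)) <= 1 - x.
Proof.
move=> /andP[x0 x1]; rewrite expRN.
apply: (@le_trans _ _ (1 + 2 * x)^-1).
  by rewrite lef_pV2 ?posrE ?expR_gt0 ?expR_ge1Dx//; lra.
by rewrite -[leLHS]mul1r ler_pdivrMr; nra.
Qed.

Definition coshR x := (expR x + expR (- x)) / 2.

Lemma coshR_ge x : -2 <= x <= 2 -> 1 + x ^+ 2 / 4 <= coshR x.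
Proof.
move=> /andP[x1 x2].
have sqr_exp y : -2 <= y -> (1 + y / 2) ^+ 2 <= expR y.
  move=> y2; have -> : expR y = expR (y / 2) ^+ 2.
    by rewrite -expRM_natl; congr expR; lra.
  by rewrite lerXn2r ?nnegrE ?expR_ge0 ?expR_ge1Dx//; lra.
have := sqr_exp x x1; have := sqr_exp (- x); rewrite /coshR; nra.
Qed.

Lemma coshR_le x : x ^+ 2 <= 2^-1 -> coshR x <= expR (2 * x ^+ 2).
Proof.
move=> x2; apply: le_trans (expR_ge1Dx _).
have x1 : x < 1 by nra.
have x1' : - x < 1 by nra.
have h : (1 - x)^-1 + (1 - - x)^-1 <= 2 * (1 + 2 * x ^+ 2).
  have -> : (1 - x)^-1 + (1 - - x)^-1 = 2 / (1 - x ^+ 2).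
    by field; apply/and3P; split; apply/eqP; nra.
  by rewrite ler_pdivrMr; nra.
by have := expR_le_inv x1; have := expR_le_inv x1'; rewrite /coshR; lra.
Qed.

End elementary_bounds.

(** Outcomes with g below half its mean M contribute at most M / 2 to M, so the
    remaining ones contribute at least M / 2; Cauchy-Schwarz bounds that part by
    the second moment of g and the probability of being above M / 2. *)
Lemma paley_zygmund (R : realType) (T : finType) (w g : T -> R) :
  (forall x, 0 <= w x) -> \sum_x w x = 1 -> 0 <= \sum_x w x * g x ->
  (\sum_x w x * g x) ^+ 2 <=
  4 * (\sum_x w x * g x ^+ 2) *
    \sum_(x | (\sum_x w x * g x) / 2 <= g x) w x.
Proof.
move=> w0 w1; set M := \sum_x w x * g x => M0.
pose B x := M / 2 <= g x.
set r := \sum_(x | _) w x.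
have MB : M / 2 <= \sum_x w x * (g x * (B x)%:R).
  have : M <= \sum_x w x * (g x * (B x)%:R) + \sum_x w x * (M / 2).
    rewrite -big_split/=; apply: ler_sum => x _.
    rewrite -mulrDr ler_wpM2l//; have [Bx|Bx] := boolP (B x).
      by rewrite mulr1; lra.
    by move: Bx; rewrite /B -ltNge mulr0; lra.
  by rewrite -mulr_suml w1; lra.
have := cauchy_schwarz_sum (fun x => Num.sqrt (w x) * g x)
  (fun x => Num.sqrt (w x) * (B x)%:R).
have -> : \sum_x Num.sqrt (w x) * g x * (Num.sqrt (w x) * (B x)%:R) =
    \sum_x w x * (g x * (B x)%:R).
  apply: eq_bigr => x _; rewrite -[w x in RHS]sqr_sqrtr//; ring.
have -> : \sum_x (Num.sqrt (w x) * g x) ^+ 2 = \sum_x w x * g x ^+ 2.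
  by apply: eq_bigr => x _; rewrite exprMn sqr_sqrtr.
have -> : \sum_x (Num.sqrt (w x) * (B x)%:R) ^+ 2 = r.
  rewrite /r [RHS]big_mkcond/=; apply: eq_bigr => x _.
  by rewrite exprMn sqr_sqrtr// -/(B x); case: (B x); rewrite ?expr1n ?mulr1// expr0n/= mulr0.
have : (M / 2) ^+ 2 <= (\sum_x w x * (g x * (B x)%:R)) ^+ 2.
  by rewrite lerXn2r ?nnegrE//; lra.
nra.
Qed.

(** * Fluctuations of the Euclidean norm *)

Section sign_sum.
Variables (R : realType) (n : nat).

Definition sign_sum (x : outcomes n) : R :=
  \sum_(i < n) (if (x i).2 then 1 else -1).

Local Notation W := (product_weight (n := n) (four_point_weight (2^-1 : R))).

Lemma half_weight_ge0 s : 0 <= four_point_weight (2^-1 : R) s.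
Proof. by rewrite /four_point_weight; case: s.2; lra. Qed.

Lemma sign_sum_mgf (l : R) :
  \sum_x W x * expR (l * sign_sum x) = coshR l ^+ n.
Proof.
transitivity (\sum_x W x * \prod_(i < n) expR (l * (if (x i).2 then 1 else -1))).
  by apply: eq_bigr => x _; rewrite -expR_sum mulr_sumr.
rewrite (sum_product_weight _ (fun _ s => expR (l * (if s.2 then 1 else -1)))).
rewrite prodr_const card_ord; congr (_ ^+ _).
by rewrite sum_four_point/= mulr1 mulrN1 /coshR; field.
Qed.

(** Moderate deviations of a sum of n fair signs, by the Paley-Zygmund inequality
    for exp(l S): with l^2 = 16 p / n the mean cosh(l)^n is at least e^(2p), so
    half of it still exceeds e^p, while the second moment cosh(2 l)^n is at most
    e^(128 p). Either sign of l is allowed, which serves both tails. *)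
Lemma sign_sum_deviation (p : nat) (l : R) : (1 <= p)%N ->
  l ^+ 2 <= 8^-1 -> l ^+ 2 * n%:R = 16 * p%:R ->
  expR (- (130 * p%:R)) <= \sum_(x | p%:R <= l * sign_sum x) W x.
Proof.
move=> p1 l8 ln.
have p1R : 1 <= p%:R :> R by rewrite ler1n.
have W0 := product_weight_ge0 (n := n) half_weight_ge0.
have W1 : \sum_x W x = 1 := product_weight_sum n (sum_four_point_weight _).
have l2 : -2 <= l <= 2 by apply/andP; split; nra.
have M1 : expR (2 * p%:R) <= coshR l ^+ n.
  apply: (@le_trans _ _ (expR (l ^+ 2 / 8) ^+ n)).
    by rewrite -expRM_natl ler_expR; lra.
  rewrite lerXn2r ?nnegrE ?expR_ge0//.
    by rewrite /coshR divr_ge0// addr_ge0// expR_ge0.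
  apply: le_trans (coshR_ge l2).
  have -> : l ^+ 2 / 8 = l ^+ 2 / 4 / 2 by lra.
  by apply: expR_half_le; nra.
have V1 : coshR (2 * l) ^+ n <= expR (128 * p%:R).
  have -> : 128 * p%:R = n%:R * (2 * (2 * l) ^+ 2) by rewrite exprMn; lra.
  rewrite expRM_natl lerXn2r ?nnegrE ?expR_ge0//.
    by rewrite /coshR divr_ge0// addr_ge0// expR_ge0.
  by apply: coshR_le; rewrite exprMn; lra.
have e2 : 4 <= expR (2 * p%:R) :> R.
  apply: (@le_trans _ _ (expR 1 ^+ 2)); last first.
    by rewrite -expRM_natl ler_expR; lra.
  have [h _] := expR1_bounds R.
  by rewrite (_ : 4 = 2 ^+ 2 :> R); [rewrite lerXn2r ?nnegrE ?expR_ge0|ring].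
have := @paley_zygmund R _ W (fun x => expR (l * sign_sum x)) W0 W1.
rewrite sign_sum_mgf.
have -> : \sum_x W x * expR (l * sign_sum x) ^+ 2 = coshR (2 * l) ^+ n.
  rewrite -sign_sum_mgf; apply: eq_bigr => x _.
  by rewrite -expRM_natl mulrA.
set Pr := \sum_(x | _) W x.
have e20 := expR_gt0 (2 * p%:R : R).
move=> /(_ (le_trans (ltW e20) M1)) PZ.
have Pr0 : 0 <= Pr by exact: sumr_ge0.
apply: (@le_trans _ _ Pr); last first.
  rewrite /Pr big_mkcond [leRHS]big_mkcond/=; apply: ler_sum => x _.
  case: ifPn => [xB|_]; last by case: ifP.
  suff -> : p%:R <= l * sign_sum x by [].
  rewrite -ler_expR (le_trans _ xB)//.
  apply: (@le_trans _ _ (expR (2 * p%:R) / 2)); last by lra.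
  have ep : expR (2 * p%:R) = expR p%:R ^+ 2 :> R by rewrite -expRM_natl.
  by have := expR_gt0 (p%:R : R); rewrite ep in e2 *; nra.
have -> : 130 * p%:R = 2 * p%:R + 128 * p%:R :> R by lra.
rewrite expRN -div1r ler_pdivrMr ?expR_gt0// expRD.
have : expR (2 * p%:R) ^+ 2 <= 4 * expR (128 * p%:R) * Pr.
  apply: (@le_trans _ _ ((coshR l ^+ n) ^+ 2)).
    by rewrite lerXn2r ?nnegrE ?(le_trans _ M1)// ltW.
  by apply: (le_trans PZ); rewrite ler_wpM2r// ler_wpM2l.
have := expR_gt0 (128 * p%:R : R).
have : 0 <= expR (128 * p%:R) * Pr by rewrite mulr_ge0// expR_ge0.
nra.
Qed.

End sign_sum.

Lemma thresholded_norm0_tensor_power (R : realType) n d (v : 'I_n -> R) :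
  thresholded_norm 0 (tensor_power d v) = Num.sqrt (\sum_i v i ^+ 2) ^+ d.
Proof.
have -> : thresholded_norm 0 (tensor_power d v) = tensor_norm (tensor_power d v).
  congr Num.sqrt; apply: eq_bigr => a _.
  by rewrite /soft_threshold subr0 max_l// -normrX ger0_norm ?sqr_ge0// expr2.
rewrite /tensor_norm tensor_dot_elementary prodr_const card_ord.
have -> : \sum_i v i * v i = \sum_i v i ^+ 2 by apply: eq_bigr => i _; rewrite expr2.
rewrite -[in LHS](sqr_sqrtr (sum_sqr_ge0 v)) -exprM mulnC exprM sqrtr_sqr.
by rewrite ger0_norm// exprn_ge0// sqrtr_ge0.
Qed.

(** The coordinates are 0 with probability 1/2 and +sqrt 2 or -sqrt 2 with
    probability 1/4, so that |X|^2 = n + S with S a sum of n fair signs, and the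
    norm of the d-th tensor power is (n + S)^(d/2). Both S <= 0 and
    S >= sqrt(n p) / 4 have probability at least e^(-130 p), and between these
    levels the d-th power grows by a factor at least 1 + d h / 12, where
    h = sqrt(p / n). *)
Lemma norm_anti_concentration (R : realType) (n d p : nat) :
  (1 <= d)%N -> (1 <= p)%N -> 128 * p%:R <= n%:R :> R ->
  finite_anti_concentration n d 2
    (d%:R * Num.sqrt n%:R ^+ d.-1 * Num.sqrt p%:R / 24)
    (expR (- (130 * p%:R)) : R).
Proof.
move=> d1 p1 pn.
have p1R : 1 <= p%:R :> R by rewrite ler1n.
have n0 : 0 < n%:R :> R by lra.
have e2 : expR (2 / 4) <= 2 :> R.
  apply: le_trans (expR_le_inv _) _; first by lra.
  by rewrite (_ : 1 - 2 / 4 = 2^-1); [rewrite invrK|lra].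
have [|||P [X [Pw Xv Xn]]] :=
  @exists_four_point_family R 2^-1 (Num.sqrt 2) 0 n.
- by apply/andP; split; lra.
- by rewrite sqr_sqrtr//; lra.
- by rewrite sqr_sqrtr// expr0n/= mul0r expR0; lra.
exists (product_weight (four_point_weight 2^-1)), P, X, (thresholded_norm 0).
split => //.
- by split => //; exact: (product_weight_ge0 (@half_weight_ge0 R)).
- exact: thresholded_norm_convex_lipschitz1.
have fE x : thresholded_norm 0 (tensor_power d (X ^~ x)) =
    Num.sqrt (n%:R + sign_sum R x) ^+ d.
  rewrite thresholded_norm0_tensor_power; congr (Num.sqrt _ ^+ _).
  have -> : n%:R = \sum_(i < n) 1 :> R by rewrite sumr_const card_ord.
  rewrite /sign_sum -big_split/=; apply: eq_bigr => i _.
  rewrite Xv sqr_four_point_value sqr_sqrtr// expr0n/=.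
  by case: (x i).2; lra.
pose h := Num.sqrt (p%:R / n%:R : R).
have hh : h ^+ 2 * n%:R = p%:R by rewrite sqr_sqrtr ?divr_ge0// divfK// gt_eqF.
have h0 : 0 < h by rewrite sqrtr_gt0 divr_gt0//; lra.
have h2 : h ^+ 2 <= 128^-1 by rewrite sqr_sqrtr ?divr_ge0// ler_pdivrMr//; lra.
have hn : Num.sqrt n%:R * h = Num.sqrt p%:R by rewrite -sqrtrM// mulrC divfK// gt_eqF.
have dev (l : R) : l ^+ 2 = (4 * h) ^+ 2 ->
    expR (- (130 * p%:R)) <=
    \sum_(x : outcomes n | p%:R <= l * sign_sum R x)
       product_weight (four_point_weight (2^-1 : R)) x.
  move=> l2; apply: sign_sum_deviation => //; rewrite l2 exprMn; lra.
move=> m.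
apply: (two_level_deviation (l := Num.sqrt n%:R ^+ d) m _
  (dev (- (4 * h)) (sqrrN _)) (dev (4 * h) erefl)).
- exact: (product_weight_ge0 (@half_weight_ge0 R)).
- move=> x Sx; rewrite fE lerXn2r ?nnegrE ?sqrtr_ge0// ler_wsqrtr//.
  have : sign_sum R x <= 0 by nra.
  lra.
- move=> x Sx; rewrite fE.
  have Sx' : h * n%:R / 4 <= sign_sum R x.
    rewrite -(ler_pM2l h0); nra.
  apply: (@le_trans _ _ ((Num.sqrt n%:R * (1 + h / 12)) ^+ d)); last first.
    rewrite lerXn2r ?nnegrE ?sqrtr_ge0//.
      by rewrite mulr_ge0 ?sqrtr_ge0//; lra.
    rewrite -(ger0_norm (_ : 0 <= 1 + h / 12)); last by lra.
    rewrite -sqrtr_sqr -sqrtrM// ler_wsqrtr//.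
    nra.
  rewrite exprMn.
  have := bernoulli_ineq d (_ : -1 <= h / 12) => /(_ ltac:(lra)).
  move=> /(ler_wpM2l (exprn_ge0 d (sqrtr_ge0 (n%:R : R)))); apply: le_trans.
  rewrite -hn.
  have -> : Num.sqrt n%:R ^+ d = Num.sqrt n%:R * Num.sqrt n%:R ^+ d.-1 :> R.
    by rewrite -exprS prednK.
  by rewrite le_eqVlt; apply/orP; left; apply/eqP; field.
Qed.

(** * Sparse large coordinates *)

Lemma card_setC_ord n (J : {set 'I_n}) : #|finset.setC J| = (n - #|J|)%N.
Proof. by rewrite cardsCs finset.setCK card_ord. Qed.

(** Each factor (n - i) / (p - i) of the binomial coefficient is at least n / p. *)
Lemma expn_le_binM (n p : nat) : (p <= n)%N -> (n ^ p <= 'C(n, p) * p ^ p)%N.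
Proof.
move=> pn; rewrite -(leq_pmul2r (fact_gt0 p)) mulnAC bin_ffact -(ffactnn p).
have powE m : (m ^ p = \prod_(i < p) m)%N by rewrite prod_nat_const card_ord.
rewrite !ffact_prod !powE -!big_split/=.
apply: leq_prod => i _; rewrite mulnBr mulnBl leq_sub2l//.
by rewrite (mulnC n) leq_mul2l pn orbT.
Qed.


Section big_coordinates.
Variables (R : realType) (n : nat) (q : R).
Hypothesis q01 : 0 <= q <= 1.

Local Notation W := (product_weight (n := n) (four_point_weight q)).

Definition big_set (x : outcomes n) : {set 'I_n} := [set i | (x i).2].

Lemma sum_weight_big_set (J : {set 'I_n}) :
  \sum_(x | big_set x == J) W x = q ^+ #|J| * (1 - q) ^+ (n - #|J|).
Proof.
transitivity (\sum_x W x * \prod_(i < n) ((x i).2 == (i \in J))%:R).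
  rewrite big_mkcond/=; apply: eq_bigr => x _; rewrite -natr_prod.
  case: ifPn => [/eqP <-|xJ].
    by rewrite big1 ?mulr1// => i _; rewrite inE eqxx.
  have [i iJ] : exists i, (x i).2 != (i \in J).
    apply/existsP; rewrite -negb_forall; apply: contra xJ => /forallP h.
    by apply/eqP/setP => i; rewrite inE; exact/eqP.
  by rewrite (bigD1 i)//= (negPf iJ) mul0n mulr0.
rewrite (sum_product_weight _ (fun i s => (s.2 == (i \in J))%:R)).
transitivity (\prod_(i < n) (if i \in J then q else 1 - q)).
  apply: eq_bigr => i _; rewrite sum_four_point/=.
  by case: (i \in J) => /=; field.
rewrite (bigID (mem J))/=; congr (_ * _).
  by rewrite (eq_bigr (fun=> q)) ?prodr_const// => i ->.
rewrite (eq_bigr (fun=> 1 - q)) ?prodr_const => [|i /negPf ->//].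
congr (_ ^+ _); rewrite -card_setC_ord.
by apply: eq_card => i; rewrite !inE.
Qed.

Lemma prob_no_big : \sum_(x | big_set x == finset.set0) W x = (1 - q) ^+ n.
Proof. by rewrite sum_weight_big_set cards0 expr0 mul1r subn0. Qed.

Lemma prob_card_big p :
  \sum_(x | #|big_set x| == p) W x = 'C(n, p)%:R * (q ^+ p * (1 - q) ^+ (n - p)).
Proof.
rewrite (partition_big big_set (fun J => #|J| == p))//=.
transitivity (\sum_(J : {set 'I_n} | #|J| == p) q ^+ p * (1 - q) ^+ (n - p)).
  apply: eq_bigr => J /eqP Jp; rewrite -{2 3}Jp -sum_weight_big_set.
  by apply: eq_bigl => x; have [->|] := eqVneq (big_set x) J; rewrite ?Jp ?eqxx ?andbF.
rewrite sumr_const mulr_natl; congr (_ *+ _).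
have := card_draws 'I_n p; rewrite card_ord => <-.
by apply: eq_card => J; rewrite !inE.
Qed.

End big_coordinates.

Section thresholded_tensor_power.
Variables (R : realType) (n d : nat) (a b : R) (J : {set 'I_n}) (v : 'I_n -> R).
Hypotheses (b0 : 0 <= b) (ba : b <= a).
Hypothesis vJ : forall i, `|v i| = if i \in J then a else b.

(** Every entry of the tensor power then has absolute value exactly b^d, so the
    tensor lies in the cube. *)
Lemma thresholded_norm_small : J = finset.set0 ->
  thresholded_norm (b ^+ d) (tensor_power d v) = 0.
Proof.
move=> J0; rewrite /thresholded_norm /l2norm big1 ?sqrtr0// => t _.
rewrite ffunE /soft_threshold normr_prod.
under eq_bigr do rewrite vJ J0 inE.
by rewrite prodr_const card_ord subrr max_l// expr0n.
Qed.

Let one_big (k : 'I_d) (t : {ffun 'I_d -> 'I_n}) :=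
  [forall l, (t l \in J) == (l == k)].

Let card_one_big (k : 'I_d) :
  #|one_big k| = (#|J| * (n - #|J|) ^ d.-1)%N.
Proof.
transitivity (\sum_(t : {ffun 'I_d -> 'I_n})
    \prod_(l < d) ((t l \in J) == (l == k) : nat)).
  rewrite -sum1_card big_mkcond/=; apply: eq_bigr => t _.
  case: ifPn => [/forallP h|].
    by rewrite big1// => l _; rewrite h.
  rewrite negb_forall => /existsP[l /negPf lk].
  by rewrite (bigD1 l)//= lk.
rewrite -(bigA_distr_bigA (fun l i => ((i \in J) == (l == k) : nat))).
rewrite (bigD1 k)//= eqxx; congr (_ * _)%N.
  by rewrite -sum1_card [RHS]big_mkcond/=; apply: eq_bigr => i _; case: (i \in J).
rewrite (eq_bigr (fun=> n - #|J|)%N).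
  by rewrite prod_nat_const cardC1 card_ord.
move=> l /negPf ->; rewrite -card_setC_ord -sum1_card.
rewrite [RHS]big_mkcond/=; apply: eq_bigr => i _.
by rewrite !inE; case: (i \in J).
Qed.

(** Multi-indices with exactly one slot in J carry entries of absolute value
    a b^(d-1), which exceed the threshold b^d by b^(d-1) (a - b). The free choice
    of that slot is the source of the factor d. *)
Lemma thresholded_norm_large :
  (d * (#|J| * (n - #|J|) ^ d.-1))%:R * (b ^+ d.-1 * (a - b)) ^+ 2 <=
  thresholded_norm (b ^+ d) (tensor_power d v) ^+ 2.
Proof.
rewrite sqr_l2norm; set V := _ ^+ 2.
have V0 : 0 <= V by exact: sqr_ge0.
have -> : (d * (#|J| * (n - #|J|) ^ d.-1))%:R * V =
    \sum_(t : {ffun 'I_d -> 'I_n}) \sum_(k < d) (if one_big k t then V else 0).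
  rewrite exchange_big/= (eq_bigr (fun=> (#|J| * (n - #|J|) ^ d.-1)%:R * V)).
    by rewrite sumr_const card_ord natrM -mulrA mulr_natl.
  move=> k _; rewrite -big_mkcond/= sumr_const mulr_natl -(card_one_big k).
  by congr (_ *+ _); apply: eq_card.
apply: ler_sum => t _.
have [/existsP[k hk]|] := boolP [exists k, one_big k t]; last first.
  rewrite negb_exists => /forallP h.
  by rewrite big1 ?sqr_ge0// => k _; rewrite (negPf (h k)).
have tk l : (t l \in J) = (l == k) by move/forallP: hk => /(_ l)/eqP.
rewrite (bigD1 k)//= hk big1 ?addr0; last first.
  move=> l lk; case: ifPn => // /forallP /(_ k)/eqP.
  by rewrite tk eqxx => /esym/eqP kl; rewrite kl eqxx in lk.
have -> : soft_threshold (b ^+ d) (tensor_power d v t) = b ^+ d.-1 * (a - b).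
  rewrite ffunE /soft_threshold normr_prod (bigD1 k)//= vJ tk eqxx.
  rewrite (eq_bigr (fun=> b)); last by move=> l /negPf lk; rewrite vJ tk lk.
  rewrite prodr_const cardC1 card_ord.
  have -> : b ^+ d = b * b ^+ d.-1 by rewrite -exprS prednK// (leq_trans _ (ltn_ord k)).
  rewrite -mulrBl mulrC max_l// mulr_ge0 ?exprn_ge0 ?subr_ge0//.
by [].
Qed.

End thresholded_tensor_power.

(** With e^L = e + 1/q, the square of q e^(L/2) is q^2 (e + 1/q) = q (e q + 1),
    which is at most 2 q; the bound on q L follows because L / 2 <= e^(L/2). *)
Lemma ln_inverse_bounds (R : realType) (q : R) : 0 < q <= 128^-1 ->
  let L := ln (expR 1 + q^-1) in
  [/\ 3 <= L, q * expR (L / 2) <= 2^-1 & (q * L) ^+ 2 <= 8 * q].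
Proof.
move=> /andP[q0 q1] L.
have [e2 e4] := expR1_bounds R.
have yq : (expR 1 + q^-1) * q = expR 1 * q + 1 by rewrite mulrDl mulVf// gt_eqF.
have eL : expR L = expR 1 + q^-1.
  by rewrite lnK// posrE addr_gt0 ?expR_gt0 ?invr_gt0.
have L3 : 3 <= L.
  rewrite -ler_expR eL; have -> : expR 3 = expR 1 ^+ 3 :> R.
    by rewrite -expRM_natl mulr1.
  apply: (@le_trans _ _ (4 ^+ 3)).
    by rewrite lerXn2r ?nnegrE ?expR_ge0.
  by rewrite -(ler_pM2r q0) yq (_ : 4 ^+ 3 = 64); [nra|ring].
have E2 : (q * expR (L / 2)) ^+ 2 <= 2 * q.
  have -> : (q * expR (L / 2)) ^+ 2 = q * (expR L * q).
    rewrite exprMn -expRM_natl (_ : 2 * (L / 2) = L); first by ring.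
    by field.
  by rewrite eL yq; nra.
have E0 : 0 <= q * expR (L / 2) by rewrite mulr_ge0 ?expR_ge0 ?ltW.
clearbody L; split => //; first by nra.
have LE : q * L <= 2 * (q * expR (L / 2)).
  by have := ler_wpM2l (ltW q0) (expR_ge1Dx (L / 2)); lra.
have qL0 : 0 <= q * L by apply: mulr_ge0; lra.
by nra.
Qed.

(** By Bernoulli's inequality the factors (1 - q)^(d-1) and b^(2(d-1)) lost to
    the small coordinates are at least 3/4 as long as d q and d q L are at most
    1/4, and a >= 3/2 makes a - b at least a third of a = sqrt L. *)
Lemma sparse_scale_bound (R : realType) (n d p : nat) (q L a b : R) :
  (p <= n)%N -> 0 <= q -> q * n%:R = p%:R -> d%:R * q <= 4^-1 ->
  0 <= q * L -> d%:R * (q * L) <= 4^-1 -> q * L <= 1 ->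
  1 - q * L <= b ^+ 2 -> b <= 1 -> a ^+ 2 = L -> 3 / 2 <= a -> q <= 1 ->
  (2 * (Num.sqrt n%:R ^+ d.-1 * Num.sqrt (d%:R * p%:R * L) / 24)) ^+ 2 <=
  (d * (p * (n - p) ^ d.-1))%:R * (b ^+ d.-1 * (a - b)) ^+ 2.
Proof.
move=> pn q0 qn dq qL0 dqL qL1 b2 b1 a2 a_ge q1.
have dle : (d.-1)%:R <= d%:R :> R by rewrite ler_nat leq_pred.
have bern (x : R) : 0 <= x <= 1 -> d%:R * x <= 4^-1 -> 3 / 4 <= (1 - x) ^+ d.-1.
  move=> /andP[x0 x1] dx.
  have := bernoulli_ineq d.-1 (_ : -1 <= - x) => /(_ ltac:(lra)).
  by apply: le_trans; have := ler_wpM2r x0 dle; lra.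
have B1 : 3 / 4 <= (1 - q) ^+ d.-1 by apply: bern => //; exact/andP.
have B2 : 3 / 4 <= (b ^+ 2) ^+ d.-1.
  apply: le_trans (bern _ _ dqL) _; first exact/andP.
  by rewrite lerXn2r ?nnegrE ?sqr_ge0 ?subr_ge0.
have B3 : L / 9 <= (a - b) ^+ 2 by rewrite -a2; clear -b1 a_ge; nra.
have L0 : 0 <= L by rewrite -a2 sqr_ge0.
have np : ((n - p)%N%:R : R) = n%:R * (1 - q).
  by rewrite natrB// -qn; ring.
have -> : (2 * (Num.sqrt n%:R ^+ d.-1 * Num.sqrt (d%:R * p%:R * L) / 24)) ^+ 2
    = (n%:R ^+ d.-1 * (d%:R * p%:R)) * (L / 144).
  rewrite !exprMn sqr_sqrtr; last by rewrite !mulr_ge0.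
  by rewrite -exprM mulnC exprM sqr_sqrtr//; field.
have -> : (d * (p * (n - p) ^ d.-1))%:R * (b ^+ d.-1 * (a - b)) ^+ 2 =
    (n%:R ^+ d.-1 * (d%:R * p%:R)) *
      ((1 - q) ^+ d.-1 * (b ^+ 2) ^+ d.-1 * (a - b) ^+ 2).
  have -> : (b ^+ 2) ^+ d.-1 = (b ^+ d.-1) ^+ 2 by rewrite -!exprM mulnC.
  by rewrite !natrM natrX np !exprMn; ring.
apply: ler_wpM2l; first by rewrite !mulr_ge0 ?exprn_ge0.
have B12 : 9 / 16 <= (1 - q) ^+ d.-1 * (b ^+ 2) ^+ d.-1.
  have := ler_pM (_ : 0 <= 3 / 4) (_ : 0 <= 3 / 4) B1 B2.
  by move=> /(_ ltac:(clear; lra) ltac:(clear; lra)); lra.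
have := ler_pM (_ : 0 <= 9 / 16) (_ : 0 <= L / 9) B12 B3.
by move=> /(_ ltac:(clear; lra) ltac:(lra)); clear -L0; lra.
Qed.

(** At q = p / n the factor C(n, p) q^p is at least 1, so having exactly p large
    coordinates is at least as likely as having none. *)
Lemma prob_card_big_ge (R : realType) (n p : nat) (q : R) :
  (1 <= p <= n)%N -> 0 <= q <= 2^-1 -> q = p%:R / n%:R ->
  expR (- (2 * p%:R)) <= (1 - q) ^+ n <=
  'C(n, p)%:R * (q ^+ p * (1 - q) ^+ (n - p)).
Proof.
move=> /andP[p1 pn] q01 qE; have /andP[q0 q1] := q01.
have n0 : 0 < n%:R :> R by rewrite ltr0n (leq_trans p1).
have q1' : 0 <= 1 - q by lra.
apply/andP; split.
  have -> : - (2 * p%:R) = n%:R * (- (2 * q)).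
    by rewrite qE; field; rewrite gt_eqF.
  by rewrite expRM_natl lerXn2r ?nnegrE ?expR_ge0// expRN2_le.
rewrite -[in leLHS](subnKC pn) exprD mulrA ler_wpM2r ?exprn_ge0//.
apply: (@le_trans _ _ 1); first by rewrite exprn_ile1//; lra.
rewrite qE expr_div_n mulrA ler_pdivlMr ?exprn_gt0// mul1r.
by rewrite -!natrX -natrM ler_nat expn_le_binM.
Qed.

(** Each coordinate has absolute value a = sqrt L, L = ln(e + n/p), with
    probability q = p / n, and absolute value b otherwise, where b is fixed by the
    variance; L is the largest value of a^2, up to constants, that the
    sub-Gaussian bound allows. The function is the distance to the cube of radius
    b^d. It vanishes when no coordinate is large, and its square is at least of
    order d p n^(d-1) L when exactly p coordinates are large. The hypothesis on n
    keeps d q L bounded, so that the entries of the tensor power lose only a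
    constant factor through the small coordinates. *)
Lemma sparse_anti_concentration (R : realType) (n d p : nat) :
  (1 <= d)%N -> (1 <= p)%N -> 128 * p%:R * d%:R ^+ 2 <= n%:R :> R ->
  finite_anti_concentration n d 2
    (Num.sqrt n%:R ^+ d.-1 *
       Num.sqrt (d%:R * p%:R * ln (expR 1 + n%:R / p%:R)) / 24)
    (expR (- (130 * p%:R)) : R).
Proof.
move=> d1 p1 pnd.
have p1R : 1 <= p%:R :> R by rewrite ler1n.
have d1R : 1 <= d%:R :> R by rewrite ler1n.
have n0 : 0 < n%:R :> R.
  by apply: lt_le_trans pnd; rewrite !mulr_gt0 ?exprn_gt0 ?ltr0n.
pose q : R := p%:R / n%:R.
have q0 : 0 < q by rewrite divr_gt0 ?n0 ?ltr0n.
have qn : q * n%:R = p%:R by rewrite divfK// gt_eqF.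
have qV : n%:R / p%:R = q^-1 by rewrite invf_div.
have qd2 : q * d%:R ^+ 2 <= 128^-1.
  by rewrite -(ler_pM2r n0) mulrAC qn; lra.
clear pnd.
have qE : q = p%:R / n%:R by [].
clearbody q.
have qd : d%:R * q <= 128^-1.
  by apply: le_trans qd2; rewrite mulrC ler_pM2l// expr2 ler_peMl.
have q1 : q <= 128^-1 by apply: le_trans qd; rewrite ler_peMl// ltW.
rewrite qV; have [L3 qE2 qL2] := ln_inverse_bounds (introT andP (conj q0 q1)).
move: L3 qE2 qL2; set L := ln _ => L3 qE2 qL2; clearbody L.
have L0 : 0 <= L by apply: le_trans L3.
have qL0 : 0 <= q * L by rewrite mulr_ge0 ?(ltW q0).
have dqL : d%:R * (q * L) <= 4^-1.
  rewrite -(ler_pXn2r (n := 2))// ?nnegrE ?mulr_ge0 ?(ltW q0)// exprMn.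
  apply: (@le_trans _ _ (d%:R ^+ 2 * (8 * q))).
    by rewrite ler_wpM2l ?sqr_ge0.
  by have -> : 4^-1 ^+ 2 = 16^-1 :> R by [field]; clear -qd2; lra.
have qL1 : q * L <= 4^-1 by apply: le_trans dqL; rewrite ler_peMl.
have q1' : 0 < 1 - q by clear -q1; lra.
pose a := Num.sqrt L; pose b := Num.sqrt ((1 - q * L) / (1 - q)).
have a2 : a ^+ 2 = L by rewrite sqr_sqrtr.
have b2 : b ^+ 2 = (1 - q * L) / (1 - q).
  by rewrite sqr_sqrtr// divr_ge0 ?(ltW q1')//; clear -qL1; lra.
have b0 : 0 <= b := sqrtr_ge0 _.
have a0 : 0 <= a := sqrtr_ge0 _.
clearbody a b.
have b2ge : 1 - q * L <= b ^+ 2.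
  by rewrite b2 ler_pdivlMr//; clear -q0 qL1; nra.
have b2le : b ^+ 2 <= 1.
  by rewrite b2 ler_pdivrMr//; clear -q0 L3; nra.
have b1 : b <= 1 by clear -b0 b2le; nra.
have a_ge : 3 / 2 <= a by clear -a0 a2 L3; nra.
have q01 : 0 <= q <= 2^-1 by rewrite (ltW q0)/=; clear -q1; lra.
have q01' : 0 <= q <= 1 by rewrite (ltW q0)/=; clear -q1; lra.
have [||P [X [Pw Xv Xn]]] := @exists_four_point_family R q a b n q01'.
- by rewrite a2 b2 [(1 - q) * _]mulrC divfK ?gt_eqF//; ring.
- have h1 : q * expR (a ^+ 2 / 4) <= 2^-1.
    apply: le_trans qE2.
    by rewrite a2 ler_pM2l// ler_expR; clear -L0; lra.
  have h2 : expR (b ^+ 2 / 4) <= 4 / 3.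
    apply: (@le_trans _ _ (expR 4^-1)).
      by rewrite ler_expR; clear -b2le; lra.
    apply: le_trans (expR_le_inv _) _; first by clear; lra.
    by rewrite (_ : 1 - 4^-1 = (4 / 3)^-1); [rewrite invrK|field].
  by have := expR_gt0 (b ^+ 2 / 4); clear -h1 h2 q0; nra.
exists (product_weight (four_point_weight q)), P, X, (thresholded_norm (b ^+ d)).
have W0 x : 0 <= product_weight (n := n) (four_point_weight q) x.
  apply: product_weight_ge0 => s; rewrite divr_ge0//.
  by case: s.2; rewrite ltW.
split => //; first exact: thresholded_norm_convex_lipschitz1.
have absX x i : `|X i x| = if i \in big_set x then a else b.
  by rewrite Xv normr_four_point_value// inE.
have p_le_n : (p <= n)%N.
  by rewrite -(ler_nat R) -qn ler_piMl ?ltW//; clear -q1; lra.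
have /andP[none some] :=
  prob_card_big_ge (introT andP (conj p1 p_le_n)) q01 qE.
have e130 : expR (- (130 * p%:R)) <= expR (- (2 * p%:R)) :> R.
  by rewrite ler_expR; clear -p1R; lra.
move=> m.
apply: (@two_level_deviation R _ _ _ (fun x => big_set x == finset.set0)
  (fun x => #|big_set x| == p) _ _ 0 m W0).
- by rewrite prob_no_big// (le_trans e130).
- by rewrite prob_card_big// (le_trans e130)// (le_trans none).
- by move=> x /eqP x0; rewrite (thresholded_norm_small d (absX x) x0).
- move=> x /eqP xp; rewrite add0r.
  have ba : b <= a by clear -b1 a_ge; lra.
  have := thresholded_norm_large d b0 ba (absX x); rewrite xp.
  set F := thresholded_norm _ _ => hF.
  have F0 : 0 <= F := l2norm_ge0 _.
  rewrite -(ler_pXn2r (n := 2)) ?nnegrE//.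
  apply: le_trans hF; apply: (@sparse_scale_bound _ _ _ _ q) => //.
  + exact: ltW.
  + by apply: le_trans qd _; clear; lra.
  + by apply: le_trans qL1 _; clear; lra.
  + by case/andP: q01'.
Qed.

(** * Assembly *)

Lemma powR_half_pred (R : realType) (x : R) (d : nat) : 0 <= x -> (1 <= d)%N ->
  x `^ ((d%:R - 1) / 2) = Num.sqrt x ^+ d.-1.
Proof.
move=> x0 d1; rewrite -{1}(prednK d1) -natr1 addrK mulrC powRrM powR12_sqrt//.
by rewrite powR_mulrn// sqrtr_ge0.
Qed.

Theorem theorem2p3 (R : realType) :
  exists (K0 c C : R) (n0 : nat),
    [/\ 0 < K0, 0 < c, 0 < C & (1 <= n0)%N] /\
    (forall n d p : nat,
       (n0 <= n)%N -> (1 <= d)%N -> (1 <= p)%N ->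
       p%:R <= c * n%:R / d%:R ^+ 2 ->
       anti_concentration n d K0
         (c * d%:R * n%:R `^ ((d%:R - 1) / 2) * Num.sqrt p%:R)
         (expR (- (C * p%:R))) /\
       anti_concentration n d K0
         (c * n%:R `^ ((d%:R - 1) / 2) *
            Num.sqrt (d%:R * p%:R * ln (expR 1 + n%:R / p%:R)))
         (expR (- (C * p%:R)))) /\
    (exists2 c' : R, 0 < c' &
       forall n d p : nat,
         (n0 <= n)%N -> (1 <= d)%N -> (1 <= p)%N ->
         p%:R <= c * n%:R / d%:R ^+ 2 ->
         exists (disp : measure_display) (T : measurableType disp)
             (P : probability T R) (X : 'I_n -> {RV P >-> R})
             (f : tensor_space R n d -> R),
           [/\ normalized_subgaussian K0 X,
               convex_lipschitz1 f &
               let Z (w : T) : R := f (tensor_power d (X ^~ w)) in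
               ((c' * n%:R `^ ((d%:R - 1) / 2) *
                   (d%:R * Num.sqrt p%:R +
                    Num.sqrt (d%:R * p%:R * ln (expR 1 + n%:R / p%:R))))%:E
                <= 'N[P]_(p%:R%:E) [(fun w => (Z w - fine 'E_P[Z])%:E)])%E]).
Proof.
(* With c = 1/128, (d q L)^2 <= 8 d^2 q <= 1/16 for q = p / n. The exponent 130
   is the 128 of the Paley-Zygmund bound plus 2 for its factor 1/4. *)
exists 2, (128^-1), 130, 1%N.
have pnd n d p : (1 <= d)%N -> p%:R <= 128^-1 * n%:R / d%:R ^+ 2 :> R ->
    128 * p%:R * d%:R ^+ 2 <= n%:R :> R.
  move=> d1; rewrite ler_pdivlMr ?exprn_gt0 ?ltr0n//; lra.
have pn n d p : (1 <= d)%N -> p%:R <= 128^-1 * n%:R / d%:R ^+ 2 :> R ->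
    128 * p%:R <= n%:R :> R.
  move=> d1 /(pnd _ _ _ d1); apply: le_trans.
  by rewrite ler_peMr ?mulr_ge0// exprn_ege1// ler1n.
split; first by split => //; lra.
split.
  move=> n d p _ d1 p1 pnd1.
  have B0 : 0 <= Num.sqrt n%:R ^+ d.-1 :> R by rewrite exprn_ge0 ?sqrtr_ge0.
  split; rewrite powR_half_pred//.
  - apply: finite_anti_concentrationW (norm_anti_concentration d1 p1 (pn _ _ _ d1 pnd1)) => //.
    have : 0 <= d%:R * Num.sqrt n%:R ^+ d.-1 * Num.sqrt p%:R :> R.
      by rewrite !mulr_ge0 ?sqrtr_ge0.
    lra.
  - apply: finite_anti_concentrationW (sparse_anti_concentration d1 p1 (pnd _ _ _ d1 pnd1)) => //.
    set s := Num.sqrt (_ * _).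
    have : 0 <= Num.sqrt n%:R ^+ d.-1 * s by rewrite !mulr_ge0 ?sqrtr_ge0.
    lra.
exists (expR (- 130) / 48); first by rewrite divr_gt0 ?expR_gt0.
move=> n d p _ d1 p1 pnd1; rewrite powR_half_pred//.
set B := Num.sqrt n%:R ^+ d.-1; set s := Num.sqrt (_ * _).
have B0 : 0 <= B by rewrite exprn_ge0 ?sqrtr_ge0.
have s0 : 0 <= s := sqrtr_ge0 _.
have r0 : 0 <= d%:R * Num.sqrt p%:R :> R by rewrite mulr_ge0 ?sqrtr_ge0.
have EB0 : 0 <= expR (- 130) * B :> R by rewrite mulr_ge0 ?expR_ge0.
(* The larger of the two terms is at least half of their sum. *)
have [sr|/ltW rs] := leP s (d%:R * Num.sqrt p%:R).
- apply: finite_anti_concentration_Lnorm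
    (norm_anti_concentration d1 p1 (pn _ _ _ d1 pnd1)) => //.
  by have := ler_wpM2l EB0 sr; rewrite -/B; lra.
- apply: finite_anti_concentration_Lnorm
    (sparse_anti_concentration d1 p1 (pnd _ _ _ d1 pnd1)) => //.
  by have := ler_wpM2l EB0 rs; rewrite -/B -/s; lra.
Qed.
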